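(* Let $\mathcal P$ be an $\mathsf{NPO}\text{-}\mathsf{PB}$ problem with input size $s$, problem Hamiltonian $H_C$, QWOA parameters $(\boldsymbol\gamma,\mathbf t)$ and initial state $|\psi_0\rangle$. Then $$\operatorname{Var}_{\boldsymbol\gamma,\mathbf t}\big[L_{\boldsymbol\gamma,\mathbf t}(|\psi_0\rangle\langle\psi_0|,H_C)\big]=\Omega\!\left(\frac{1}{\mathrm{poly}(s)}\right),$$ so the QWOA loss for $\mathcal P$ exhibits no barren plateau (the variance is not $\mathcal O(b^{-s})$ for any $b>1$).
   Context: For an instance with feasible space $\mathcal S'$ and cost $C$, $|\psi_0\rangle=|\mathcal S'|^{-1/2}\sum_{z\in\mathcal S'}|z\rangle$, $H_C|z\rangle=C(z)|z\rangle$, and $H_M$ is the complete-graph (equivalently, up to identity, all-ones) matrix on $\mathcal S'$. The QWOA loss is $L_{\boldsymbol\gamma,\mathbf t}(\rho,O)=\operatorname{Tr}[U(\boldsymbol\gamma,\mathbf t)\rho U(\boldsymbol\gamma,\mathbf t)^\dagger O]$ with $U(\boldsymbol\gamma,\mathbf t)=\prod_{l=1}^p e^{-it_lH_M}e^{-i\gamma_lH_C}$. The DLA $\mathfrak g=\mathfrak g_{\mathrm{QWOA},\mathcal P}$ is the real Lie algebra generated by $iH_C,iH_M$ (closure under commutators). Being reductive, $\mathfrak g=\mathfrak g_1\oplus\cdots\oplus\mathfrak g_{r-1}\oplus\mathfrak g_r$ with $\mathfrak g_1,\dots,\mathfrak g_{r-1}$ simple ideals and $\mathfrak g_r$ the center.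 For a Hermitian $H$ and ideal $\mathfrak g_j$, the $\mathfrak g_j$-purity is $P_j(H)=\sum_{k=1}^{\dim\mathfrak g_j}|\operatorname{Tr}[E_k^\dagger H]|^2$ for an orthonormal (Hilbert–Schmidt) basis $\{E_k\}$ of $\mathfrak g_j$. The variance is the one given by the Lie-algebraic formula (for parameters making the circuit distributed as Haar measure on the Lie group of $\mathfrak g$): $\operatorname{Var}[L(\rho,O)]=\sum_{j=1}^{r-1}P_j(\rho)P_j(O)/\dim\mathfrak g_j$. $\mathsf{NPO}\text{-}\mathsf{PB}$: optimization problems with polynomial-size solutions, polynomial-time feasibility and cost evaluation, and costs in a discrete range of size polynomial in $s$.
   Formalization: The bound is stated for instances whose cost takes at least two values on the feasible space (for constant cost the variance is 0, so the claim fails); the closing ''no barren plateau'' sentence, an immediate consequence, is not stated separately. *)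

(* Defs.v *)
(* Real scalars: Stdlib's concrete reals R (an rcfType via
   Rstruct); complex scalars: R[i] from mathcomp-real-closed. *)
From HB Require Import structures.
From mathcomp Require Import all_boot all_order all_algebra.
From mathcomp Require Import complex.
From mathcomp Require Import Rstruct.
From Stdlib Require Rdefinitions.
Notation R := Rdefinitions.R.

Set Implicit Arguments.
Unset Strict Implicit.
Unset Printing Implicit Defensive.

Import Order.TTheory GRing.Theory Num.Theory.
Local Open Scope ring_scope.
Local Open Scope complex_scope.

(* complex numbers *)
Notation CC := (complex R).

Section QWOA_DLA.
Variable d : nat.

(* real dimension of the real vector space of d x d complex matrices *)
Definition NR := (d * d + d * d)%N.

(* real-linear coordinates of a complex matrix: (Re entries, Im entries) *)
Definition vecC (X : 'M[CC]_d) : 'rV[R]_NR :=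
  row_mx (mxvec (map_mx (@complex.Re R) X)) (mxvec (map_mx (@complex.Im R) X)).

(* X belongs to the real subspace (row space) U *)
Definition inLie (X : 'M[CC]_d) (U : 'M[R]_NR) : Prop := (vecC X <= U)%MS.

Definition comm (X Y : 'M[CC]_d) : 'M[CC]_d := X *m Y - Y *m X.

Definition lie_closed (U : 'M[R]_NR) : Prop :=
  forall X Y, inLie X U -> inLie Y U -> inLie (comm X Y) U.

(* U is (the row space of) the real Lie algebra generated by iA and iB *)
Definition is_DLA (A B : 'M[CC]_d) (U : 'M[R]_NR) : Prop :=
  [/\ inLie ('i *: A) U, inLie ('i *: B) U, lie_closed U &
      forall W : 'M[R]_NR,
        inLie ('i *: A) W -> inLie ('i *: B) W -> lie_closed W -> (U <= W)%MS].

(* I is an ideal of the Lie algebra g *)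
Definition is_ideal (g I : 'M[R]_NR) : Prop :=
  (I <= g)%MS /\ forall X Y, inLie X I -> inLie Y g -> inLie (comm X Y) I.

(* I is a simple Lie algebra: non-abelian, with no ideals other than 0 and I *)
Definition is_simple (I : 'M[R]_NR) : Prop :=
  (exists X Y, [/\ inLie X I, inLie Y I & comm X Y <> 0]) /\
  forall J : 'M[R]_NR, is_ideal I J -> (J == (0 : 'M[R]_NR))%MS \/ (J == I)%MS.

(* Z is the center of g *)
Definition is_center (g Z : 'M[R]_NR) : Prop :=
  (Z <= g)%MS /\
  forall X, inLie X Z <-> (inLie X g /\ forall Y, inLie Y g -> comm X Y = 0).

(* g = g_1 (+) ... (+) g_k (+) Z, direct sum of simple ideals and the center *)
Definition reductive_decomposition (g : 'M[R]_NR) (k : nat)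
    (gs : 'I_k -> 'M[R]_NR) (Z : 'M[R]_NR) : Prop :=
  [/\ forall j, is_ideal g (gs j) /\ is_simple (gs j),
      is_center g Z,
      (g == (\sum_(j < k) gs j) + Z)%MS &
      \rank g = (\sum_(j < k) \rank (gs j) + \rank Z)%N].

(* conjugate transpose *)
Definition adj (m n : nat) (X : 'M[CC]_(m, n)) : 'M[CC]_(n, m) :=
  (map_mx (fun z : CC => z^*) X)^T.

(* Es is a Hilbert-Schmidt orthonormal basis of the real subspace I *)
Definition is_onb (I : 'M[R]_NR) (Es : seq 'M[CC]_d) : Prop :=
  [/\ forall E, E \in Es -> inLie E I,
      forall a b : nat, (a < size Es)%N -> (b < size Es)%N ->
        \tr (adj (nth 0 Es a) *m nth 0 Es b) = (a == b)%:R &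
      (I <= \sum_(E <- Es) <<vecC E>>)%MS].

(* squared modulus of a complex number *)
Definition sqmod (z : CC) : R := complex.Re z ^+ 2 + complex.Im z ^+ 2.

(* g_j-purity P_j(H) = sum_k |Tr[E_k^dagger H]|^2 *)
Definition purity (Es : seq 'M[CC]_d) (H : 'M[CC]_d) : R :=
  \sum_(E <- Es) sqmod (\tr (adj E *m H)).

(* v is the Lie-algebraic variance  sum_j P_j(rho) P_j(O) / dim g_j
   for the DLA generated by iA, iB (for some reductive decomposition and
   some orthonormal bases of the simple ideals). *)
Definition LA_variance (A B rho O : 'M[CC]_d) (v : R) : Prop :=
  exists (g : 'M[R]_NR) (k : nat) (gs : 'I_k -> 'M[R]_NR) (Z : 'M[R]_NR)
         (Es : 'I_k -> seq 'M[CC]_d),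
    [/\ is_DLA A B g, reductive_decomposition g gs Z,
        forall j, is_onb (gs j) (Es j) &
        v = \sum_(j < k) purity (Es j) rho * purity (Es j) O
                          / (\rank (gs j))%:R].

End QWOA_DLA.

(* QWOA objects for an instance with feasible set S' = A and cost C.
   Basis states |z>, z in S', are indexed by 'I_#|A| via enum_val. *)
Section QWOA_instance.
Variables (T : finType) (A : {set T}) (C : T -> int).

(* H_C |z> = C(z) |z> *)
Definition H_C : 'M[CC]_#|A| :=
  diag_mx (\row_(i < #|A|) ((C (enum_val i))%:~R : CC)).

(* complete-graph mixer, in its all-ones form *)
Definition H_M : 'M[CC]_#|A| := const_mx 1.

(* |psi_0> = |S'|^{-1/2} sum_z |z> *)
Definition psi0 : 'cV[CC]_#|A| := const_mx (sqrtC (#|A|%:R : CC))^-1.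

Definition rho0 : 'M[CC]_#|A| := psi0 *m adj psi0.

End QWOA_instance.

(* Main.v *)
Require Import Defs.
From HB Require Import structures.
From mathcomp Require Import all_boot all_order all_algebra.
From mathcomp Require Import complex Rstruct.
From mathcomp Require Import ring lra zify.
From Stdlib Require Import Classical.

Set Implicit Arguments.
Unset Strict Implicit.
Unset Printing Implicit Defensive.

Import Order.TTheory GRing.Theory Num.Theory.
Local Open Scope ring_scope.

(* Write v' for the conjugate transpose of v, e for the all-ones vector, and
   J = e e'. Since i H_C does not commute with i J, some simple ideal I contains
   an X that does not preserve the line of e. Taking commutators of X with i J
   and i H_C then yields v e' - e v' in I for every v orthogonal to e in the
   H_C-cyclic space of e, which is spanned by the indicators chi_a of the cost
   level sets. Hence I contains both i(|e|^2 u u' - |u|^2 e e') for some nonzero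
   u orthogonal to e and i(|chi_b|^2 chi_a chi_a' - |chi_a|^2 chi_b chi_b') for
   distinct costs a, b, which bound the purities of rho and of H_C below by 1/2.
   Finally I = [I, I] consists of matrices constant on pairs of level sets, so
   dim I is at most 2 m^2, where the number m of levels is polynomial in s. *)

(** * Real-linear coordinates of complex matrices *)

Section RealCoordinates.
Variable d : nat.
Implicit Types (X Y : 'M[CC]_d) (U : 'M[R]_(NR d)).

Definition unvecC (v : 'rV[R]_(NR d)) : 'M[CC]_d :=
  \matrix_(i, j) Complex (vec_mx (lsubmx v) i j) (vec_mx (rsubmx v) i j).

Lemma vecCK : cancel (@vecC d) unvecC.
Proof.
move=> X; apply/matrixP => i j; rewrite mxE /vecC row_mxKl row_mxKr !mxvecK.
by rewrite !mxE; case: (X i j).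
Qed.

Lemma unvecCK : cancel unvecC (@vecC d).
Proof.
move=> v; rewrite -[RHS]hsubmxK /vecC; congr row_mx.
  rewrite -[RHS]vec_mxK; congr mxvec.
  by apply/matrixP => i j; rewrite !mxE.
rewrite -[RHS]vec_mxK; congr mxvec.
by apply/matrixP => i j; rewrite !mxE.
Qed.

Lemma vecCD X Y : vecC (X + Y) = vecC X + vecC Y.
Proof.
rewrite /vecC add_row_mx -!linearD /=.
by congr (row_mx (mxvec _) (mxvec _)); apply/matrixP => i j;
  rewrite !mxE; case: (X i j) => ? ?; case: (Y i j).
Qed.

Lemma vecCZ (r : R) X : vecC (r%:C%C *: X) = r *: vecC X.
Proof.
rewrite /vecC scale_row_mx -!linearZ /=.
by congr (row_mx (mxvec _) (mxvec _)); apply/matrixP => i j;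
  rewrite !mxE; case: (X i j) => ? ? /=; rewrite mul0r ?subr0 ?addr0.
Qed.

Lemma vecC0 : vecC (0 : 'M[CC]_d) = 0.
Proof. by have := vecCZ 0 0; rewrite scaler0 scale0r. Qed.

Lemma unvecCD u v : unvecC (u + v) = unvecC u + unvecC v.
Proof. by apply: (can_inj vecCK); rewrite vecCD !unvecCK. Qed.

Lemma unvecCZ (r : R) v : unvecC (r *: v) = r%:C%C *: unvecC v.
Proof. by apply: (can_inj vecCK); rewrite vecCZ !unvecCK. Qed.

Lemma unvecC0 : unvecC 0 = 0.
Proof. by apply: (can_inj vecCK); rewrite vecC0 unvecCK. Qed.

Lemma inLie0 U : inLie 0 U.
Proof. by rewrite /inLie vecC0 sub0mx. Qed.

Lemma inLieD U X Y : inLie X U -> inLie Y U -> inLie (X + Y) U.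
Proof. by rewrite /inLie vecCD; exact: addmx_sub. Qed.

Lemma inLieZ U (r : R) X : inLie X U -> inLie (r%:C%C *: X) U.
Proof. by rewrite /inLie vecCZ; exact: scalemx_sub. Qed.

Lemma inLie_sub U V X : (U <= V)%MS -> inLie X U -> inLie X V.
Proof. by move=> sUV /submx_trans; apply. Qed.

Lemma inLie_capmx U V X : inLie X (U :&: V)%MS <-> inLie X U /\ inLie X V.
Proof. by rewrite /inLie sub_capmx; split=> [/andP[]|[-> ->]]. Qed.

(* Subspaces are enlarged one vector at a time; the rank bounds the process. *)
Lemma subspace_mx (P : 'M[CC]_d -> Prop) :
  P 0 -> (forall X Y, P X -> P Y -> P (X + Y)) ->
  (forall (r : R) X, P X -> P (r%:C%C *: X)) ->
  exists U, forall X, inLie X U <-> P X.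
Proof.
move=> P0 PD PZ.
suff {P0} H : forall k U, (NR d - \rank U <= k)%N ->
    (forall X, inLie X U -> P X) -> exists U', forall X, inLie X U' <-> P X.
  apply: (H (NR d) 0); first exact: leq_subr.
  move=> X; rewrite /inLie submx0 => /eqP X0.
  by rewrite -[X]vecCK X0 unvecC0.
elim=> [|k IH] U hU UP.
  exists U => X; split; first exact: UP.
  move=> _; apply: submx_full; rewrite /row_full eqn_leq rank_leq_col /=.
  by rewrite -subn_eq0 -leqn0.
case: (classic (exists X, P X /\ ~ inLie X U)); last first.
  move=> nX; exists U => X; split; first exact: UP.
  by move=> PX; apply: NNPP => nXU; apply: nX; exists X.
case=> X [PX nXU]; apply: (IH (U + <<vecC X>>)%MS).
  suff : (\rank U < \rank (U + <<vecC X>>)%MS)%N.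
    by have := rank_leq_col (U + <<vecC X>>)%MS; move: hU; lia.
  have : (U < U + <<vecC X>>)%MS.
    rewrite ltmxE addsmxSl /=; apply/negP => h; apply: nXU.
    by apply: submx_trans h; apply: submx_trans (addsmxSr _ _); rewrite genmxE.
  by rewrite ltmxErank => /andP[].
move=> Y; rewrite /inLie; case/sub_addsmxP => -[u w] /= e.
rewrite -[Y]vecCK e unvecCD; apply: PD.
  by apply: UP; rewrite /inLie unvecCK submxMl.
have : (w *m <<vecC X>> <= vecC X)%MS by rewrite (submx_trans (submxMl _ _)) ?genmxE.
move=> /submxP[a ->]; rewrite [a]mx11_scalar mul_scalar_mx unvecCZ vecCK.
exact: PZ.
Qed.

(** The matrices satisfying [P] form a real Lie algebra containing both generators. [subspace_mx]
    turns it into a row space, to which the minimality of [g] applies. *)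
Lemma DLA_ind (A B : 'M[CC]_d) g (P : 'M[CC]_d -> Prop) :
  is_DLA A B g ->
  P 0 -> (forall X Y, P X -> P Y -> P (X + Y)) ->
  (forall (r : R) X, P X -> P (r%:C%C *: X)) ->
  (forall X Y, P X -> P Y -> P (comm X Y)) ->
  P ('i *: A) -> P ('i *: B) -> forall X, inLie X g -> P X.
Proof.
move=> [_ _ _ gmin] P0 PD PZ PC PA PB X Xg.
have [U hU] := subspace_mx P0 PD PZ.
apply/hU; apply: inLie_sub Xg; apply: gmin; [exact/hU|exact/hU|].
by move=> Y Z /hU PY /hU PZ'; apply/hU; exact: PC.
Qed.

End RealCoordinates.

(** * Rank-one operators and ideals containing part of a projector *)

Section Adjoint.
Variable F : numClosedFieldType.
Implicit Types a b : F.

(* Over [CC] this is convertible to [adj]; the abstract field keeps [ring] fast. *)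
Definition ctmx (m n : nat) (X : 'M[F]_(m, n)) : 'M[F]_(n, m) :=
  (map_mx (fun z => z^*) X)^T.

Lemma conjcD a b : (a + b)^* = a^* + b^*.
Proof. exact: rmorphD. Qed.

Lemma conjcN a : (- a)^* = - a^*.
Proof. exact: rmorphN. Qed.

Lemma conjcM a b : (a * b)^* = a^* * b^*.
Proof. exact: rmorphM. Qed.

Lemma conjcV a : (a^-1)^* = (a^*)^-1.
Proof. exact: fmorphV. Qed.

Definition conjcE := (conjcD, conjcN, conjcM, conjcV, @conjCi F, @conjC0 F, @conjC1 F).

Lemma ctmxE (m n : nat) (X : 'M[F]_(m, n)) i j : ctmx X i j = (X j i)^*.
Proof. by rewrite !mxE. Qed.

Lemma ctmxK (m n : nat) (X : 'M[F]_(m, n)) : ctmx (ctmx X) = X.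
Proof. by apply/matrixP => i j; rewrite !ctmxE conjCK. Qed.

Lemma ctmxD (m n : nat) (X Y : 'M[F]_(m, n)) : ctmx (X + Y) = ctmx X + ctmx Y.
Proof. by apply/matrixP => i j; rewrite !(ctmxE, mxE) conjcE. Qed.

Lemma ctmxN (m n : nat) (X : 'M[F]_(m, n)) : ctmx (- X) = - ctmx X.
Proof. by apply/matrixP => i j; rewrite !(ctmxE, mxE) conjcE. Qed.

Lemma ctmxZ (m n : nat) a (X : 'M[F]_(m, n)) : ctmx (a *: X) = a^* *: ctmx X.
Proof. by apply/matrixP => i j; rewrite !(ctmxE, mxE) conjcE. Qed.

Lemma ctmxM (m n p : nat) (X : 'M[F]_(m, n)) (Y : 'M[F]_(n, p)) :
  ctmx (X *m Y) = ctmx Y *m ctmx X.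
Proof.
apply/matrixP => i j; rewrite ctmxE !mxE rmorph_sum /=.
by apply: eq_bigr => k _; rewrite !ctmxE conjcM mulrC.
Qed.

Section RankOne.
Variable n : nat.
Implicit Types x y z w : 'cV[F]_n.

Definition dot x y : F := (ctmx x *m y) 0 0.
Definition op x y : 'M[F]_n := x *m ctmx y.

Lemma opE x y i j : op x y i j = x i 0 * (y j 0)^*.
Proof. by rewrite mxE big_ord1 ctmxE. Qed.

Lemma dotE x y : dot x y = \sum_i (x i 0)^* * y i 0.
Proof. by rewrite /dot mxE; apply: eq_bigr => i _; rewrite ctmxE. Qed.

Lemma dotC x y : (dot x y)^* = dot y x.
Proof.
rewrite !dotE rmorph_sum; apply: eq_bigr => i _.
by rewrite rmorphM /= conjCK mulrC.
Qed.

Lemma dotDr x y z : dot x (y + z) = dot x y + dot x z.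
Proof. by rewrite /dot mulmxDr mxE. Qed.

Lemma dotZr (a : F) x y : dot x (a *: y) = a * dot x y.
Proof. by rewrite /dot -scalemxAr mxE. Qed.

Lemma dotZl (a : F) x y : dot (a *: x) y = a^* * dot x y.
Proof. by rewrite /dot ctmxZ -scalemxAl mxE. Qed.

Lemma dotNl x y : dot (- x) y = - dot x y.
Proof. by rewrite /dot ctmxN mulNmx mxE. Qed.

Lemma dotDl x y z : dot (x + y) z = dot x z + dot y z.
Proof. by rewrite /dot ctmxD mulmxDl mxE. Qed.

Lemma dot_ctmx (X : 'M[F]_n) x y : dot x (X *m y) = dot (ctmx X *m x) y.
Proof. by rewrite /dot ctmxM ctmxK mulmxA. Qed.

Lemma dot_eq0 x : dot x x = 0 -> x = 0.
Proof.
rewrite dotE => /eqP; rewrite psumr_eq0 => [|i _]; last first.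
  by rewrite mulrC mul_conjC_ge0.
move=> /allP h; apply/matrixP => i j; rewrite ord1 mxE; apply/eqP.
by have := h i (mem_index_enum i); rewrite /= mulf_eq0 conjC_eq0 orbb.
Qed.

Lemma ctmx_op x y : ctmx (op x y) = op y x.
Proof. by rewrite /op ctmxM ctmxK. Qed.

Lemma op_mul x y z w : op x y *m op z w = dot y z *: op x w.
Proof.
rewrite /op mulmxA -(mulmxA x) [ctmx y *m z]mx11_scalar mul_mx_scalar.
by rewrite -scalemxAl.
Qed.

Lemma op_mulv x y z : op x y *m z = dot y z *: x.
Proof. by rewrite /op -mulmxA [ctmx y *m z]mx11_scalar mul_mx_scalar. Qed.

Lemma mul_op (X : 'M[F]_n) x y : X *m op x y = op (X *m x) y.
Proof. by rewrite /op mulmxA. Qed.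

Lemma op_mulm (X : 'M[F]_n) x y : op x y *m X = op x (ctmx X *m y).
Proof. by rewrite /op ctmxM ctmxK mulmxA. Qed.

Lemma tr_op x y : \tr (op x y) = dot y x.
Proof. by rewrite /op mxtrace_mulC trace_mx11. Qed.

End RankOne.
End Adjoint.

(** * Lie subspaces stable under commutation with iH and iJ *)

Section ProjectorIdeal.
Variable F : numClosedFieldType.
Variables (n : nat) (e : 'cV[F]_n) (H : 'M[F]_n) (L : 'M[F]_n -> Prop).
Let N := dot e e.
Let J := op e e.
Hypothesis N0 : N != 0.
Hypothesis L_0 : L 0.
Hypothesis L_D : forall X Y, L X -> L Y -> L (X + Y).
Hypothesis L_Z : forall (a : F) X, a^* = a -> L X -> L (a *: X).
Hypothesis L_skew : forall X, L X -> ctmx X = - X.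
Hypothesis L_comm : forall X Y, L X -> L Y -> L (X *m Y - Y *m X).
Hypothesis L_H : forall X, L X -> L (X *m ('i *: H) - 'i *: H *m X).
Hypothesis L_J : forall X, L X -> L (X *m ('i *: J) - 'i *: J *m X).

(** This is N times the orthogonal projection onto the complement of e; the factor N avoids a
    division. *)
Definition eproj v := N *: v - dot e v *: e.
Definition eskew v := op v e - op e v.
(** [L] is only a real subspace and [eskew] only real-linear. Quantifying over all complex [z] makes
    the set of such [v] a complex subspace. *)
Definition eideal v := dot e v = 0 /\ forall z, L (eskew (z *: v)).

Implicit Types (u v w : 'cV[F]_n) (a z : F) (X Y : 'M[F]_n).

Let N_real : N^* = N. Proof. exact: dotC. Qed.

Lemma eprojD u v : eproj (u + v) = eproj u + eproj v.
Proof. by rewrite /eproj scalerDr dotDr scalerDl opprD addrACA. Qed.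

Lemma eprojZ a v : eproj (a *: v) = a *: eproj v.
Proof. by rewrite /eproj dotZr scalerBr !scalerA mulrC. Qed.

Lemma eproj_e : eproj e = 0.
Proof. exact: subrr. Qed.

Lemma dot_eproj v : dot e (eproj v) = 0.
Proof. by rewrite dotDr -scaleNr !dotZr mulNr mulrC subrr. Qed.

Lemma eproj_orth v : dot e v = 0 -> eproj v = N *: v.
Proof. by move=> ev; rewrite /eproj ev scale0r subr0. Qed.

Lemma eprojK v : v = N^-1 *: (eproj v + dot e v *: e).
Proof. by rewrite subrK scalerA mulVf // scale1r. Qed.

Lemma eskewD u v : eskew (u + v) = eskew u + eskew v.
Proof. by apply/matrixP => i j; rewrite !(opE, mxE) conjcE; ring. Qed.

Lemma eskewZ a v : a^* = a -> eskew (a *: v) = a *: eskew v.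
Proof.
by move=> ha; apply/matrixP => i j; rewrite !(opE, mxE) conjcE ha; ring.
Qed.

Lemma eidealD u v : eideal u -> eideal v -> eideal (u + v).
Proof.
move=> [u0 hu] [v0 hv]; split; first by rewrite dotDr u0 v0 addr0.
by move=> z; rewrite scalerDr eskewD; exact: L_D.
Qed.

Lemma eidealZ a v : eideal v -> eideal (a *: v).
Proof.
move=> [v0 hv]; split; first by rewrite dotZr v0 mulr0.
by move=> z; rewrite scalerA.
Qed.

Lemma eideal0 : eideal 0.
Proof.
split=> [|z]; first by rewrite /dot mulmx0 mxE.
rewrite scaler0 (_ : eskew 0 = 0); first exact: L_0.
by apply/matrixP => i j; rewrite !(opE, mxE) conjcE; ring.
Qed.

(** Up to the factor N this is the commutator of Y with iJ: since Y is skew-Hermitian,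
    [dot e (Y *m e)] is purely imaginary and the J terms cancel. *)
Lemma eskew_i_eproj Y : L Y -> L (eskew ('i *: eproj (Y *m e))).
Proof.
move=> hY; have Ysk := L_skew hY.
have t0 : (dot e (Y *m e))^* = - dot e (Y *m e).
  by rewrite dotC dot_ctmx Ysk mulNmx dotNl opprK.
suff -> : eskew ('i *: eproj (Y *m e)) = N *: (Y *m ('i *: J) - 'i *: J *m Y).
  by apply: L_Z N_real _; exact: L_J.
rewrite -scalemxAl -scalemxAr mul_op op_mulm Ysk mulNmx.
apply/matrixP => i j; rewrite !(opE, mxE).
rewrite !conjcE N_real t0; ring.
Qed.

(* The double commutator with [i J] isolates the part of Y that mixes e with
   its orthogonal complement. *)
Lemma eideal_eproj Y : L Y -> eideal (eproj (Y *m e)).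
Proof.
move=> hY; set w := eproj _; have w0 : dot e w = 0 by exact: dot_eproj.
have w0' : dot w e = 0 by rewrite -dotC w0 conjcE.
have hiw : L (eskew ('i *: w)) by exact: eskew_i_eproj.
have hw : L (eskew w).
  (* A second commutator with iJ multiplies w by i once more, up to real scalars; the resulting real
     factor [- N ^+ 2] can be divided out. *)
  have /eskew_i_eproj := hiw.
  rewrite mulmxBl !op_mulv dotZl w0' mulr0 scale0r subr0 !eprojZ eproj_orth //.
  have -> : 'i *: (dot e e *: ('i *: (N *: w))) = - N ^+ 2 *: w.
    rewrite !scalerA; congr (_ *: _); rewrite -/N.
    by transitivity ('i ^+ 2 * N ^+ 2); [ring | rewrite sqrCi; ring].
  have hN : (- N ^+ 2)^* = - N ^+ 2 by rewrite expr2 !conjcE N_real.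
  rewrite eskewZ // => /(L_Z (a := (- N ^+ 2)^-1)).
  rewrite scalerA mulVf ?scale1r ?oppr_eq0 ?expf_neq0 //; apply.
  by rewrite conjcV hN.
split=> // z; rewrite [z]Crect scalerDl eskewD.
have hR : ('Re z)^* = 'Re z by apply/CrealP; exact: Creal_Re.
have hI : ('Im z)^* = 'Im z by apply/CrealP; exact: Creal_Im.
apply: L_D; first by rewrite eskewZ //; exact: L_Z.
by rewrite mulrC -scalerA eskewZ //; exact: L_Z.
Qed.

Lemma eskew_mulv v x : eskew v *m x = dot e x *: v - dot v x *: e.
Proof. by rewrite mulmxBl !op_mulv. Qed.

(** Apply to e the commutator of [eskew v] with iH. Modulo e the result combines v and [H *m v], the
    latter with nonzero coefficient -iN, so it can be solved for [H *m v]. *)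
Lemma eideal_mulH v : eideal v -> eideal (eproj (H *m v)).
Proof.
move=> hv; have [v0 sv] := hv.
have v0' : dot v e = 0 by rewrite -dotC v0 conjcE.
have hB : L (eskew v) by rewrite -[v]scale1r.
have /L_H/eideal_eproj := hB.
rewrite mulmxBl -!mulmxA !eskew_mulv v0' scale0r subr0 -/N.
set a := dot e _; set b := dot v _.
rewrite -scaleNr -scalemxAl -scalemxAr -!scaleNr !eprojD !eprojZ eproj_e scaler0 addr0.
rewrite (eproj_orth v0) => hY.
have -> : eproj (H *m v) = (- ('i * N))^-1 *:
   ((a *: (N *: v) + -1 *: ('i *: (N *: eproj (H *m v)))) + (- (a * N)) *: v).
  move: (eproj (H *m v)) => w; apply/matrixP => i j; rewrite !mxE.
  by field; rewrite neq0Ci N0.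
by apply/eidealZ/eidealD; [rewrite scaleN1r -scaleNr|exact: eidealZ].
Qed.

(** For nonzero v orthogonal to e, the matrices [eskew v], [eskew ('i *: v)] and [eherm v] are, up
    to real factors, i times the three Pauli matrices on the span of e and v. *)
Definition eherm v := 'i *: (N *: op v v - dot v v *: J).

Lemma eherm_eideal v : eideal v -> L (eherm v).
Proof.
move=> [v0 sv]; have v0' : dot v e = 0 by rewrite -dotC v0 conjcE.
have -> : eherm v = 2^-1 *:
    (eskew v *m eskew ('i *: v) - eskew ('i *: v) *m eskew v).
  rewrite !(mulmxBl, mulmxBr) !op_mul !(dotZl, dotZr) v0 v0' -/N.
  apply/matrixP => i j; rewrite !(opE, mxE) !conjcE.
  by field.
apply: L_Z; first by rewrite conjcV conjC_nat.
by apply: L_comm; rewrite // -[v]scale1r.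
Qed.

(** With u the projection of X e, e is an eigenvector of [eherm u] with eigenvalue -i|u|^2 N. Hence
    the commutator of [eherm u] with iH maps e to -|u|^2 N H e plus a combination of u and e, which
    isolates H e. *)
Lemma eideal_projH X :
  L X -> eproj (X *m e) != 0 -> eideal (eproj (H *m e)).
Proof.
move=> /eideal_eproj; set u := eproj _ => hu u0.
have [eu _] := hu; have ue : dot u e = 0 by rewrite -dotC eu conjcE.
have q0 : dot u u != 0 by apply: contra_neq u0; exact: dot_eq0.
have /L_H/eideal_eproj := eherm_eideal hu.
have hx x : eherm u *m x =
    ('i * N * dot u x) *: u - ('i * dot u u * dot e x) *: e.
  rewrite -scalemxAl mulmxBl -!scalemxAl !op_mulv.
  by apply/matrixP => i j; rewrite !mxE /N; ring.
rewrite mulmxBl -!mulmxA !hx ue mulr0 scale0r sub0r -/N.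
set a := dot u _; set b := dot e _.
rewrite -!scaleNr -scalemxAl -scalemxAr -!scaleNr !eprojD !eprojZ eproj_e scaler0 addr0.
rewrite (eproj_orth eu) => hY.
set w := eproj (H *m e) in hY *.
have -> : w = (- (dot u u * N))^-1 *:
  (('i * N * a) *: (N *: u) + -1 *: ('i *: ((- ('i * dot u u * N)) *: w))
   + (- ('i * N * a * N)) *: u).
  clearbody w u; apply/matrixP => i j; rewrite !mxE.
  (* For [field] the imaginary unit is an atom, so the coefficient 1 is first written as -i^2. *)
  transitivity (- 'i ^+ 2 * w i j); first by rewrite sqrCi opprK mul1r.
  by field; rewrite N0 q0.
by apply/eidealZ/eidealD; [rewrite scaleN1r -scaleNr|exact: eidealZ].
Qed.

Lemma eideal_eproj_mulH y : eideal (eproj (H *m e)) ->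
  eideal (eproj y) -> eideal (eproj (H *m y)).
Proof.
move=> hH hy; rewrite [y]eprojK -scalemxAr mulmxDr -scalemxAr.
rewrite eprojZ eprojD eprojZ; apply/eidealZ/eidealD; last exact: eidealZ.
exact: eideal_mulH.
Qed.

(** Split y into its components along and orthogonal to e: in [op y y] the cross terms form an
    [eskew], and the J terms cancel by Pythagoras. *)
Lemma eherm_eproj y : eideal (eproj y) -> L (eherm y).
Proof.
move=> hy; have [_ sv] := hy.
have -> : eherm y = (N ^+ 2)^-1 *:
    (eherm (eproj y) + N *: eskew (('i * dot y e) *: eproj y)).
  have dotN : dot (eproj y) (eproj y) = N ^+ 2 * dot y y - N * dot e y * dot y e.
    rewrite {1}/eproj dotDl dotNl !dotZl dot_eproj mulr0 subr0 N_real.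
    by rewrite dotDr -scaleNr !dotZr; ring.
  rewrite /eherm dotN; apply/matrixP => i j.
  rewrite !(opE, mxE) !conjcE !dotC -?/N.
  by field.
have hN : ((N ^+ 2)^-1)^* = (N ^+ 2)^-1 by rewrite conjcV expr2 !conjcE N_real.
apply: L_Z hN _; apply: L_D; first exact: eherm_eideal.
exact: L_Z N_real _.
Qed.

(** The multiples of J cancel in the combination of [eherm x] and [eherm y], which removes e
    altogether. *)
Lemma op_pair_eherm x y : eideal (eproj x) -> eideal (eproj y) ->
  L ('i *: (dot y y *: op x x - dot x x *: op y y)).
Proof.
move=> /eherm_eproj hx /eherm_eproj hy.
have -> : 'i *: (dot y y *: op x x - dot x x *: op y y) =
    N^-1 *: (dot y y *: eherm x + (- dot x x) *: eherm y).
  by apply/matrixP => i j; rewrite /eherm !(opE, mxE); field.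
apply: L_Z; first by rewrite conjcV N_real.
by apply: L_D; apply: L_Z; rewrite ?conjcN ?dotC.
Qed.

End ProjectorIdeal.

(** * Indicators of the cost level sets *)

Section Indicator.
Variables (F : numFieldType) (n : nat) (c : 'I_n -> int).

Definition level (a : int) : 'cV[F]_n := \col_i (c i == a)%:R.

(* Lagrange interpolation: the level sets are reached by polynomials in H. *)
Lemma level_ind (P : 'cV[F]_n -> Prop) :
  (forall u v, P u -> P v -> P (u + v)) -> (forall k v, P v -> P (k *: v)) ->
  (forall v, P v -> P (diag_mx (\row_i (c i)%:~R) *m v)) ->
  P (const_mx 1) -> forall a, P (level a).
Proof.
move=> PD PZ PH P1 a.
have Pp (p : {poly F}) : P (\col_i p.[(c i)%:~R]).
  elim/poly_ind: p => [|p k IH].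
    rewrite (_ : \col_i _ = 0 *: const_mx 1); first exact: PZ.
    by apply/matrixP => i j; rewrite !mxE horner0 mul0r.
  rewrite (_ : \col_i _ = diag_mx (\row_i (c i)%:~R) *m (\col_i p.[(c i)%:~R])
     + k *: const_mx 1); first by apply: PD; [exact: PH|exact: PZ].
  by apply/matrixP => i j; rewrite mul_diag_mx !mxE !hornerE mulrC.
(* Repeated costs only repeat factors. If a is not attained, p vanishes at every cost and the
   indicator of a is zero, so the same formula holds. *)
pose p : {poly F} := \prod_(j | c j != a) ('X - (c j)%:~R%:P).
have pE x : p.[x] = \prod_(j | c j != a) (x - (c j)%:~R).
  by rewrite horner_prod; apply: eq_bigr => j _; rewrite !hornerE.
have pa : p.[a%:~R] != 0.
  rewrite pE; apply/prodf_neq0 => j; apply: contraNneq => /eqP.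
  by rewrite subr_eq0 eqr_int => /eqP ->.
rewrite (_ : level a = p.[a%:~R]^-1 *: \col_i p.[(c i)%:~R]); first exact: PZ.
apply/matrixP => i j; rewrite !mxE; case: eqVneq => [->|ca].
  by rewrite mulVf.
by rewrite [p.[(c i)%:~R]]pE (bigD1 i) //= subrr mul0r mulr0.
Qed.

End Indicator.

(** * Purities *)

Lemma sqmodE (z : CC) : (sqmod z)%:C%C = `|z| ^+ 2.
Proof. exact: add_Re2_Im2. Qed.

Lemma sqmod_ge0 z : 0 <= sqmod z.
Proof. by rewrite addr_ge0 ?sqr_ge0. Qed.

Lemma purity_ge0 d (Es : seq 'M[CC]_d) O : 0 <= purity Es O.
Proof. by apply: sumr_ge0 => E _; exact: sqmod_ge0. Qed.

Lemma Cauchy_Schwarz_sum (I : finType) (r z : I -> R) :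
  (\sum_i r i * z i) ^+ 2 <= (\sum_i r i ^+ 2) * (\sum_i z i ^+ 2).
Proof.
have sqE (a b : R) : \sum_i (a * z i - b * r i) ^+ 2 =
    a ^+ 2 * (\sum_i z i ^+ 2) + - (a * b * 2) * (\sum_i r i * z i)
    + b ^+ 2 * \sum_i r i ^+ 2.
  by rewrite !mulr_sumr -!big_split; apply: eq_bigr => i _ /=; ring.
set S := \sum_i r i ^+ 2 in sqE *.
set T := \sum_i r i * _ in sqE *; set Q := \sum_i z i ^+ 2 in sqE *.
have S0 : 0 <= S by apply: sumr_ge0 => i _; exact: sqr_ge0.
have [S_eq0|Sn0] := eqVneq S 0.
  have r0 i : r i = 0.
    move/eqP: S_eq0; rewrite psumr_eq0 => [/allP h|k _]; last exact: sqr_ge0.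
    by have := h i (mem_index_enum i); rewrite /= sqrf_eq0 => /eqP.
  by rewrite S_eq0 mul0r /T big1 ?expr0n // => i _; rewrite r0 mul0r.
(* This is the squared norm of S times the component of z orthogonal to r. *)
have : 0 <= \sum_i (S * z i - T * r i) ^+ 2.
  by apply: sumr_ge0 => i _; exact: sqr_ge0.
rewrite sqE (_ : _ + _ = S * (S * Q - T ^+ 2)); last by ring.
by rewrite pmulr_rge0 ?subr_ge0 // lt_def Sn0.
Qed.

Lemma sqmod_sum (I : finType) (r : I -> R) (z : I -> CC) :
  sqmod (\sum_i (r i)%:C%C * z i)
    <= (\sum_i r i ^+ 2) * (\sum_i sqmod (z i)).
Proof.
have ReM (k : R) (w : CC) : complex.Re (k%:C%C * w) = k * complex.Re w.
  by case: w => a b /=; rewrite mul0r subr0.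
have ImM (k : R) (w : CC) : complex.Im (k%:C%C * w) = k * complex.Im w.
  by case: w => a b /=; rewrite mul0r addr0.
rewrite /sqmod big_split mulrDr /=.
have -> : complex.Re (\sum_i (r i)%:C%C * z i) = \sum_i r i * complex.Re (z i).
  rewrite (big_morph _ (id1 := 0) (op1 := +%R)) //; last by case=> ? ? [].
  by apply: eq_bigr => i _; exact: ReM.
have -> : complex.Im (\sum_i (r i)%:C%C * z i) = \sum_i r i * complex.Im (z i).
  rewrite (big_morph _ (id1 := 0) (op1 := +%R)) //; last by case=> ? ? [].
  by apply: eq_bigr => i _; exact: ImM.
by apply: lerD; exact: Cauchy_Schwarz_sum.
Qed.

Section Purity.
Variable d : nat.
Implicit Types (X O : 'M[CC]_d) (I : 'M[R]_(NR d)) (Es : seq 'M[CC]_d).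

Lemma onb_coord I Es X : is_onb I Es -> inLie X I ->
  exists r : 'I_(size Es) -> R, X = \sum_k (r k)%:C%C *: nth 0 Es k.
Proof.
move=> [_ _ sI] /(inLie_sub sI); rewrite /inLie (big_nth 0) big_mkord.
case/sub_sumsmxP => u e.
have hk k : exists r : R, u k *m <<vecC (nth 0 Es k)>>%MS = vecC (r%:C%C *: nth 0 Es k).
  have : (u k *m <<vecC (nth 0 Es k)>> <= vecC (nth 0 Es k))%MS.
    by rewrite (submx_trans (submxMl _ _)) ?genmxE.
  by case/submxP=> a ->; exists (a 0 0); rewrite [a]mx11_scalar mul_scalar_mx vecCZ !mxE.
have [r hr] := fin_all_exists hk.
exists r; rewrite -[X]vecCK e (eq_bigr _ (fun k _ => hr k)).
rewrite (big_morph _ (@unvecCD d) (@unvecC0 d)).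
by apply: eq_bigr => k _; rewrite vecCK.
Qed.

(** Cauchy-Schwarz in the real coordinates of X along [Es]. Any nonzero test matrix X in I thus
    bounds the purity of O from below. *)
Lemma purity_ge I Es X O : is_onb I Es -> inLie X I ->
  `|\tr (ctmx X *m O)| ^+ 2 <= \tr (ctmx X *m X) * (purity Es O)%:C%C.
Proof.
move=> hE hX; have [r hr] := onb_coord hE hX.
have trO O' : \tr (ctmx X *m O') =
    \sum_k (r k)%:C%C * \tr (ctmx (nth 0 Es k) *m O').
  rewrite [in LHS]hr (big_morph _ (@ctmxD _ d d) (_ : ctmx 0 = 0)); last first.
    by apply/matrixP => i j; rewrite ctmxE !mxE conjC0.
  rewrite mulmx_suml raddf_sum; apply: eq_bigr => k _ /=.
  by rewrite ctmxZ -scalemxAl mxtraceZ; congr (_ * _); exact: conjc_real.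
have -> : \tr (ctmx X *m X) = (\sum_k r k ^+ 2)%:C%C.
  rewrite trO rmorph_sum; apply: eq_bigr => k _ /=.
  rewrite expr2 rmorphM; congr (_ * _).
  rewrite [X in _ *m X]hr mulmx_sumr raddf_sum (bigD1 k) //=.
  rewrite -scalemxAr mxtraceZ big1 => [|l lk].
    case: hE => _ /(_ k k (ltn_ord k) (ltn_ord k)) h _.
    by rewrite [\tr _]h eqxx mulr1 addr0.
  rewrite -scalemxAr mxtraceZ.
  case: hE => _ /(_ k l (ltn_ord k) (ltn_ord l)) h _.
  by rewrite [\tr _]h eq_sym (negbTE lk : (l == k :> nat) = false) mulr0.
rewrite -sqmodE -rmorphM lecR trO; apply: (le_trans (sqmod_sum _ _)).
by rewrite /purity [X in _ <= _ * X](big_nth 0) big_mkord.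
Qed.

(** Take the matrix of the second hypothesis as test matrix W in [purity_ge]. Orthogonality of x and
    y gives tr(W' W) = 2 (|x|^2 |y|^2)^2, while the last hypothesis says |tr(W' O)| >= |x|^2 |y|^2;
    the quotient is 1/2. *)
Lemma purity_pair_ge I Es O (x y : 'cV[CC]_d) : is_onb I Es ->
  inLie ('i *: (dot y y *: op x x - dot x x *: op y y)) I ->
  dot x y = 0 -> x != 0 -> y != 0 ->
  `|dot x x * dot y y| <= `|dot y y * dot x (O *m x) - dot x x * dot y (O *m y)| ->
  2^-1 <= purity Es O.
Proof.
move=> hE hW xy0 x0 y0 hO.
have yx0 : dot y x = 0 by rewrite -dotC xy0 conjC0.
have s0 : 0 < `|dot x x * dot y y|.
  rewrite normr_gt0 mulf_neq0 //; first by apply: contra_neq x0; exact: dot_eq0.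
  by apply: contra_neq y0; exact: dot_eq0.
have adjW : ctmx ('i *: (dot y y *: op x x - dot x x *: op y y)) =
    - 'i *: (dot y y *: op x x - dot x x *: op y y).
  by rewrite ctmxZ ctmxD ctmxN !ctmxZ !ctmx_op !dotC conjCi.
have := purity_ge O hE hW; rewrite adjW.
have -> : \tr (- 'i *: (dot y y *: op x x - dot x x *: op y y) *m O) =
   - 'i * (dot y y * dot x (O *m x) - dot x x * dot y (O *m y)).
  rewrite -scalemxAl mxtraceZ mulmxBl raddfB /= -!scalemxAl !mxtraceZ.
  by rewrite ![\tr (op _ _ *m O)]mxtrace_mulC !mul_op !tr_op.
have -> : \tr (- 'i *: (dot y y *: op x x - dot x x *: op y y) *m
    ('i *: (dot y y *: op x x - dot x x *: op y y))) =
    2 * (dot x x * dot y y) ^+ 2.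
  rewrite -scalemxAl -scalemxAr !mxtraceZ mulrA mulNr -expr2 sqrCi opprK mul1r.
  rewrite mulmxBl !mulmxBr -!scalemxAl -!scalemxAr !op_mul xy0 yx0 !scale0r !scaler0.
  rewrite subr0 sub0r opprK raddfD /= !mxtraceZ !tr_op; ring.
rewrite normrM normrN normCi mul1r.
have dotR (z : 'cV[CC]_d) : dot z z = `|dot z z|.
  apply/esym/ger0_norm; rewrite dotE; apply: sumr_ge0 => i _.
  by rewrite mulrC mul_conjC_ge0.
have -> : (dot x x * dot y y) ^+ 2 = `|dot x x * dot y y| ^+ 2.
  by rewrite normrM -!dotR.
move=> h; have {h} : `|dot x x * dot y y| ^+ 2 * 1 <=
    `|dot x x * dot y y| ^+ 2 * (2 * (purity Es O)%:C%C).
  rewrite mulr1 mulrCA mulrA; apply: le_trans h.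
  by rewrite lerXn2r // nnegrE.
rewrite ler_pM2l ?exprn_gt0 //.
have -> : 1 = 1%:C%C :> CC by [].
have -> : 2 = 2%:C%C :> CC by rewrite rmorph_nat.
rewrite -rmorphM lecR; lra.
Qed.

End Purity.

(** * The dynamical Lie algebra *)

Section LevelConstant.
Variables (n : nat) (c : 'I_n -> int).
Let H : 'M[CC]_n := diag_mx (\row_i (c i)%:~R).

Definition level_const (X : 'M[CC]_n) := forall i i' j j',
  c i = c i' -> c j = c j' -> X i j = X i' j'.

Lemma level_const0 : level_const 0.
Proof. by move=> i i' j j' _ _; rewrite !mxE. Qed.

Lemma level_constD X Y :
  level_const X -> level_const Y -> level_const (X + Y).
Proof.
move=> hX hY i i' j j' ci cj.
by rewrite !mxE (hX _ _ _ _ ci cj) (hY _ _ _ _ ci cj).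
Qed.

Lemma level_constZ a X : level_const X -> level_const (a *: X).
Proof. by move=> hX i i' j j' ci cj; rewrite !mxE (hX _ _ _ _ ci cj). Qed.

Lemma level_constB X Y :
  level_const X -> level_const Y -> level_const (X - Y).
Proof.
by move=> hX hY; rewrite -scaleN1r; apply: level_constD; last exact: level_constZ.
Qed.

Lemma level_constM X Y :
  level_const X -> level_const Y -> level_const (X *m Y).
Proof.
move=> hX hY i i' j j' ci cj; rewrite !mxE; apply: eq_bigr => k _.
by rewrite (hX _ _ k k ci erefl) (hY k k _ _ erefl cj).
Qed.

Lemma level_const_mulH X : level_const X -> level_const (H *m X).
Proof.
move=> hX i i' j j' ci cj.
by rewrite !mul_diag_mx !mxE ci (hX _ _ _ _ ci cj).
Qed.

Lemma level_const_Hmul X : level_const X -> level_const (X *m H).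
Proof.
move=> hX i i' j j' ci cj.
by rewrite !mul_mx_diag !mxE cj (hX _ _ _ _ ci cj).
Qed.

(** The diagonal H need not be constant on pairs of level sets, so the induction tracks matrices of
    the form r H + M with M level-constant. In a commutator of two of these the H H terms cancel and
    the rest is level-constant. *)
Lemma DLA_comm_level_const g X Y : is_DLA H (const_mx 1) g ->
  inLie X g -> inLie Y g -> level_const (comm X Y).
Proof.
move=> hg hX hY.
pose P X := exists (r : CC) M, level_const M /\ X = r *: H + M.
have Pcomm A B : P A -> P B -> level_const (comm A B).
  move=> [r [M [hM ->]]] [s [M' [hM' ->]]].
  have -> : comm (r *: H + M) (s *: H + M') =
    r *: (H *m M' - M' *m H) + s *: (M *m H - H *m M) + (M *m M' - M' *m M).
    rewrite /comm !(mulmxDl, mulmxDr) -!(scalemxAl, scalemxAr).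
    move: (H *m H) (H *m M) (H *m M') (M *m H) (M' *m H) (M *m M') (M' *m M).
    by move=> *; apply/matrixP => i j; rewrite !mxE; ring.
  apply: level_constD; first apply: level_constD.
  - by apply/level_constZ/level_constB;
      [exact: level_const_mulH|exact: level_const_Hmul].
  - by apply/level_constZ/level_constB;
      [exact: level_const_Hmul|exact: level_const_mulH].
  - by apply: level_constB; exact: level_constM.
have Pg Z : inLie Z g -> P Z.
  apply: (DLA_ind hg) => {X Y hX hY}.
  - by exists 0, 0; rewrite scale0r addr0; split=> //; exact: level_const0.
  - move=> X Y [r [M [hM ->]]] [s [M' [hM' ->]]].
    exists (r + s), (M + M'); split; first exact: level_constD.
    by rewrite scalerDl addrACA.
  - move=> k X [r [M [hM ->]]]; exists (k%:C%C * r), (k%:C%C *: M).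
    by split; [exact: level_constZ|rewrite scalerDr scalerA].
  - move=> X Y hX hY; exists 0, (comm X Y); rewrite scale0r add0r.
    by split=> //; exact: Pcomm.
  - by exists 'i, 0; rewrite addr0; split=> //; exact: level_const0.
  - exists 0, ('i *: const_mx 1); rewrite scale0r add0r; split=> //.
    by apply: level_constZ => i i' j j' _ _; rewrite !mxE.
by apply: Pcomm; exact: Pg.
Qed.

(* Non-abelian simplicity forces I = [I, I]. *)
Lemma simple_level_const g I X : is_DLA H (const_mx 1) g -> is_ideal g I ->
  is_simple I -> inLie X I -> level_const X.
Proof.
move=> hg [sIg hI] [[Y [Z [hY hZ YZ0]]] simI] hX.
have [|||U hU] := @subspace_mx n level_const.
- exact: level_const0.
- exact: level_constD.
- by move=> r; exact: level_constZ.
(* Containing all commutators of I makes [I :&: U] an ideal of I, and a nonzero commutator excludes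
   that it is zero. *)
have hJ A B : inLie A I -> inLie B I -> inLie (comm A B) (I :&: U)%MS.
  move=> hA hB; apply/inLie_capmx; split; first exact/hI/(inLie_sub sIg).
  by apply/hU/(DLA_comm_level_const hg); exact: inLie_sub sIg _.
have [|/eqmxP J0|/eqmxP JI] := simI (I :&: U)%MS.
- split; first exact: capmxSl.
  by move=> A B /inLie_capmx[hA _] hB; exact: hJ.
- case: YZ0; have := hJ _ _ hY hZ; rewrite /inLie J0 submx0 => /eqP e.
  by rewrite -[LHS]vecCK e unvecC0.
- by apply/hU; have := hX; rewrite /inLie -JI => /inLie_capmx[].
Qed.

Section Rank.
Variables (m : nat) (f : 'I_n -> 'I_m).

Definition pull (v : 'rV[R]_(NR m)) : 'rV[R]_(NR n) :=
  vecC (mxsub f f (unvecC v)).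

Lemma pull_is_linear : linear pull.
Proof.
move=> r u v; rewrite /pull unvecCD unvecCZ -vecCZ -vecCD; congr vecC.
by apply/matrixP => i j; rewrite !mxE.
Qed.

HB.instance Definition _ :=
  GRing.isLinear.Build R 'rV[R]_(NR m) 'rV[R]_(NR n) _ pull pull_is_linear.

Lemma rank_level_const (I : 'M[R]_(NR n)) :
  (forall i j, f i = f j -> c i = c j) ->
  (forall X, inLie X I -> level_const X) -> (\rank I <= NR m)%N.
Proof.
move=> hf hI; apply: leq_trans (rank_leq_row (lin1_mx pull)).
apply/mxrankS/row_subP => k; rewrite -[row k I]unvecCK.
have /hI : inLie (unvecC (row k I)) I by rewrite /inLie unvecCK row_sub.
move: (unvecC _) => X hX.
(* Any representative of a fibre of f gives the same entry; the value 0 on empty fibres is never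
   read by the pullback. *)
pose M : 'M[CC]_m := \matrix_(p, q)
  if [pick i | f i == p] is Some i then
    if [pick j | f j == q] is Some j then X i j else 0 else 0.
apply/submxP; exists (vecC M); rewrite mul_rV_lin1 /= /pull vecCK; congr vecC.
apply/matrixP => i j; rewrite !mxE.
case: pickP => [i' /eqP/hf ci|/(_ i)]; last by rewrite eqxx.
case: pickP => [j' /eqP/hf cj|/(_ j)]; last by rewrite eqxx.
exact: hX.
Qed.

End Rank.
End LevelConstant.

(** * Variance bound for a diagonal integer cost *)

Section Variance.
Variables (n : nat) (c : 'I_n -> int).
Let H : 'M[CC]_n := diag_mx (\row_i (c i)%:~R).
Let e : 'cV[CC]_n := const_mx 1.

Lemma op_ones : op e e = const_mx 1 :> 'M[CC]_n.
Proof. by apply/matrixP => i j; rewrite opE !mxE conjC1 mulr1. Qed.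

Lemma dot_ones : dot e e = n%:R.
Proof.
rewrite dotE (eq_bigr (fun=> 1)); last by move=> i _; rewrite !mxE conjC1 mulr1.
by rewrite sumr_const card_ord.
Qed.

Lemma DLA_skew g X : is_DLA H (const_mx 1) g -> inLie X g -> ctmx X = - X.
Proof.
move=> hg; apply: (DLA_ind (P := fun X => ctmx X = - X) hg) => {X}.
- by apply/matrixP => i j; rewrite ctmxE !mxE conjC0 oppr0.
- by move=> X Y hX hY; rewrite ctmxD hX hY opprD.
- move=> r X hX; rewrite ctmxZ hX scalerN; congr (- (_ *: _)).
  exact: conjc_real.
- move=> X Y hX hY; rewrite /comm ctmxD ctmxN !ctmxM hX hY.
  by rewrite !(mulmxN, mulNmx) !opprK opprB.
- rewrite ctmxZ conjCi scaleNr; congr (- (_ *: _)).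
  apply/matrixP => i j; rewrite ctmxE !mxE rmorphMn /= eq_sym.
  by case: eqVneq => [->|]; rewrite ?mulr0n // !mulr1n rmorph_int.
- rewrite ctmxZ conjCi scaleNr; congr (- (_ *: _)).
  by apply/matrixP => i j; rewrite ctmxE !mxE conjC1.
Qed.

(* If every ideal fixed the line of e, so would H, and the cost would be
   constant. *)
Lemma simple_ideal_moves_ones g k (gs : 'I_k -> 'M[R]_(NR n)) Z i1 i2 :
  is_DLA H (const_mx 1) g -> reductive_decomposition g gs Z -> c i1 <> c i2 ->
  exists j X, inLie X (gs j) /\ eproj e (X *m e) != 0.
Proof.
move=> hg [_ [_ hZ] /andP[sg _] _] c12.
have n0 : n%:R != 0 :> CC.
  by rewrite pnatr_eq0 -lt0n; exact: leq_ltn_trans (leq0n i1) (ltn_ord i1).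
have [gH gJ _ _] := hg.
apply: NNPP => nX.
have hgs j X : inLie X (gs j) -> eproj e (X *m e) = 0.
  move=> hX; apply/eqP; apply: contra_notT nX => h; by exists j, X.
have hZ0 X : inLie X Z -> eproj e (X *m e) = 0.
  (* A central X commutes with J; comparing both products on e shows that X e is a multiple of e. *)
  move=> /hZ[_ /(_ _ gJ)]; rewrite /comm -op_ones -scalemxAr -scalemxAl -scalerBr.
  move/eqP; rewrite scaler_eq0 (negbTE (neq0Ci _)) /= subr_eq0.
  move=> /eqP /(congr1 (mulmx^~ e)) /=.
  rewrite -[X *m _ *m e]mulmxA op_mulv -[_ *m X *m e]mulmxA op_mulv -scalemxAr => h.
  by rewrite /eproj h subrr.
have : inLie ('i *: H) ((\sum_(j < k) gs j) + Z)%MS by exact: inLie_sub sg gH.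
case/sub_addsmxP => -[u w] /= /(congr1 (@unvecC n)); rewrite vecCK unvecCD.
have /sub_sumsmxP[v hv] := submxMl u (\sum_(j < k) gs j)%MS.
rewrite hv (big_morph _ (@unvecCD n) (@unvecC0 n)) => HE.
have : eproj e ('i *: H *m e) = 0.
  rewrite HE mulmxDl eprojD (hZ0 (unvecC (w *m Z))) ?addr0; last first.
    by rewrite /inLie unvecCK submxMl.
  rewrite mulmx_suml (big_morph _ (@eprojD _ _ _) (_ : eproj e 0 = 0)).
    by rewrite big1 // => j _; apply: (hgs j); rewrite /inLie unvecCK submxMl.
  by rewrite /eproj scaler0 /dot mulmx0 mxE scale0r subr0.
rewrite -scalemxAl eprojZ => /eqP; rewrite scaler_eq0 (negbTE (neq0Ci _)) /= => /eqP h.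
case: c12; apply/eqP; rewrite -(eqr_int CC); apply/eqP/(mulfI n0).
(* Entry i of the equation [eproj e (H *m e) = 0] has a right-hand side that does not depend on
   i. *)
have hi i : n%:R * (c i)%:~R = dot e (H *m e).
  move: h; rewrite /eproj dot_ones; move: (dot e (H *m e)) => s /matrixP/(_ i 0).
  by rewrite mul_diag_mx !mxE !mulr1 => /eqP; rewrite subr_eq0 => /eqP.
by rewrite !hi.
Qed.

Lemma dot_level a b : dot (level CC c a) (level CC c b) =
  (a == b)%:R * (\sum_i (c i == a))%:R.
Proof.
rewrite dotE natr_sum mulr_sumr; apply: eq_bigr => i _; rewrite !mxE conjC_nat.
by case: eqVneq => [->|]; rewrite ?mul0r ?mulr0 // mul1r mulr1.
Qed.

Lemma mulH_level a : H *m level CC c a = a%:~R *: level CC c a.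
Proof.
apply/matrixP => i j; rewrite mul_diag_mx !mxE.
by case: eqVneq => [->|]; rewrite ?mulr0.
Qed.

Lemma level_neq0 i : level CC c (c i) != 0.
Proof.
apply/negP => /eqP/matrixP/(_ i 0) /eqP; rewrite !mxE eqxx; exact/negP/oner_neq0.
Qed.

(** One summand suffices: for the ideal that moves e, both purities are at least 1/2 and the
    dimension is at most 2 (K+1)^2, whence the constant 8. *)
Lemma LA_variance_ge (lo : int) (K : nat) (v : R) i1 i2 : c i1 <> c i2 ->
  (forall i, lo <= c i /\ c i <= lo + K%:Z) ->
  LA_variance H (const_mx 1) (n%:R^-1 *: const_mx 1) H v ->
  (8 * (K.+1 ^ 2)%:R)^-1 <= v.
Proof.
move=> c12 hc [g [k [gs [Z [Es [hg hdec hEs ->]]]]]].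
have [j0 [X [hX X0]]] := simple_ideal_moves_ones hg hdec c12.
have [hgs _ _ _] := hdec; have [hI hS] := hgs j0.
have [sIg cI] := hI; have [gH gJ _ _] := hg.
have n0 : dot e e != 0.
  rewrite dot_ones pnatr_eq0 -lt0n.
  exact: leq_ltn_trans (leq0n i1) (ltn_ord i1).
have gJ' : inLie ('i *: op e e) g by rewrite op_ones.
pose L X := inLie X (gs j0).
have L_0 : L 0 by exact: inLie0.
have L_D Y Y' : L Y -> L Y' -> L (Y + Y') by exact: inLieD.
have L_Z (a : CC) Y : a^* = a -> L Y -> L (a *: Y).
  case: a => a b; case=> /eqP; rewrite eqNr => /eqP ->; exact: inLieZ.
have L_skew Y : L Y -> ctmx Y = - Y.
  by move=> hY; apply: (DLA_skew hg); exact: inLie_sub hY.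
have L_comm Y Y' : L Y -> L Y' -> L (Y *m Y' - Y' *m Y).
  by move=> hY hY'; apply: cI => //; exact: inLie_sub hY'.
have L_H Y : L Y -> L (Y *m ('i *: H) - 'i *: H *m Y).
  by move=> hY; exact: cI.
have L_J Y : L Y -> L (Y *m ('i *: op e e) - 'i *: op e e *m Y).
  by move=> hY; exact: cI _ _ hY gJ'.
have eproj_H : eideal e L (eproj e (H *m e)).
  exact: (eideal_projH n0 L_D L_Z L_skew L_comm L_H L_J hX X0).
have hlev a : eideal e L (eproj e (level CC c a)).
  apply: (level_ind (P := fun y => eideal e L (eproj e y))).
  - by move=> u w hu hw; rewrite eprojD; exact: eidealD.
  - by move=> z w hw; rewrite eprojZ; exact: eidealZ.
  - by move=> y; exact: (eideal_eproj_mulH n0 L_D L_Z L_skew L_H L_J eproj_H).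
  - by rewrite eproj_e; exact: eideal0.
have purH : 2^-1 <= purity (Es j0) H.
  have d12 : dot (level CC c (c i1)) (level CC c (c i2)) = 0.
    by rewrite dot_level (negbTE (introN eqP c12)) mul0r.
  apply: (purity_pair_ge (hEs j0) _ d12 (level_neq0 _) (level_neq0 _)).
    exact: (op_pair_eherm n0 L_D L_Z L_comm (hlev _) (hlev _)).
  rewrite !mulH_level !dotZr; move: (dot _ _) (dot _ _) => q p.
  have -> : q * ((c i1)%:~R * p) - p * ((c i2)%:~R * q) =
      p * q * (c i1 - c i2)%:~R by rewrite rmorphB /=; ring.
  (* Distinct integer costs differ by at least 1 in absolute value. *)
  rewrite [X in _ <= X]normrM ler_peMr // -intr_norm -[1]/(1%:~R) ler_int.
  by move: c12; lia.
have [uo _] := eideal_eproj n0 L_D L_Z L_skew L_J hX.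
set u := eproj e (X *m e) in uo X0.
have purR : 2^-1 <= purity (Es j0) (n%:R^-1 *: const_mx 1).
  have ue : dot u e = 0 by rewrite -dotC uo conjC0.
  have e0 : e != 0.
    by apply: contra_neq n0 => ->; rewrite /dot mulmx0 mxE.
  (* For the pair u, e the test matrix is [eherm e u]; the state annihilates u and fixes e, so the
     required inequality is an equality. *)
  apply: (purity_pair_ge (hEs j0) _ ue X0 e0).
    apply: (eherm_eideal L_Z L_comm).
    exact: (eideal_eproj n0 L_D L_Z L_skew L_J hX).
  rewrite -op_ones -!scalemxAl !op_mulv !dotZr uo mul0r !mulr0 sub0r normrN.
  by rewrite -dot_ones mulKf.
(* The costs lie among the K+1 integers from lo to lo+K, so [inord] never falls back to its default
   and f separates levels. *)
pose f i : 'I_K.+1 := inord `|c i - lo|.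
have hf i j : f i = f j -> c i = c j.
  have [hi hi'] := hc i; have [hj hj'] := hc j.
  by move/(congr1 val); rewrite /= !inordK; move: hi hi' hj hj'; lia.
have rk : (\rank (gs j0) <= NR K.+1)%N.
  by apply: (rank_level_const hf) => Y; exact: simple_level_const hg hI hS.
(* Positivity matters because division by zero gives 0, which would make the retained summand
   vanish. *)
have rk0 : (0 < \rank (gs j0))%N.
  rewrite lt0n mxrank_eq0; apply: contra_neqN X0 => /eqP gs0.
  have : X = 0.
    by move: hX; rewrite /inLie gs0 submx0 => /eqP h; rewrite -[X]vecCK h unvecC0.
  by rewrite /u => ->; rewrite mul0mx /eproj scaler0 /dot mulmx0 mxE scale0r subr0.
rewrite (bigD1 j0) //=; apply: ler_wpDr.
  by apply: sumr_ge0 => j _; rewrite divr_ge0 ?mulr_ge0 ?purity_ge0.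
apply: (@le_trans _ _ (4^-1 / (\rank (gs j0))%:R)); last first.
  rewrite ler_wpM2r ?invr_ge0 // (_ : 4^-1 = 2^-1 * 2^-1); last by field.
  by apply: ler_pM; rewrite ?invr_ge0.
rewrite -invfM lef_pV2 ?posrE ?mulr_gt0 ?ltr0n ?expn_gt0 //.
have -> : 8 = 4 * 2 :> R by rewrite -natrM.
rewrite -mulrA ler_pM2l // -natrM ler_nat (leq_trans rk) //.
by rewrite /NR mul2n -addnn mulnn.
Qed.

End Variance.

(** * QWOA instances with polynomial cost range *)

Lemma rho0E (T : finType) (A : {set T}) :
  rho0 A = (#|A|%:R)^-1 *: const_mx 1 :> 'M[CC]_#|A|.
Proof.
rewrite /rho0 /psi0; apply/matrixP => i j.
rewrite -[LHS]/(op _ _ i j) opE !mxE mulr1 conjcV.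
rewrite (_ : (sqrtC _)^* = sqrtC #|A|%:R); last first.
  by apply/CrealP/ger0_real; rewrite sqrtC_ge0.
by rewrite -invfM -expr2 sqrtCK.
Qed.

Theorem theorem4
  (Inst : Type) (size : Inst -> nat) (len : Inst -> nat)
  (feas : forall x : Inst, {set (len x).-tuple bool})
  (cost : forall x : Inst, (len x).-tuple bool -> int)
  (Hlen : exists (k c : nat), forall x, (len x <= c * size x ^ k + c)%N)
  (Hcost : exists (k c : nat), forall x, exists lo : int,
      forall z, z \in feas x ->
        (lo <= cost x z)%R /\ (cost x z <= lo + (c * size x ^ k + c)%:Z)%R) :
  exists (k s0 : nat) (c : R), 0 < c /\
    forall x : Inst, (s0 <= size x)%N ->
      (exists z1 z2, [/\ z1 \in feas x, z2 \in feas x & cost x z1 <> cost x z2]) ->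
      forall v : R,
        LA_variance (H_C (feas x) (cost x)) (H_M (feas x))
                    (rho0 (feas x)) (H_C (feas x) (cost x)) v ->
        c / ((size x ^ k)%:R) <= v.
Proof.
have [k [c hc]] := Hcost.
(* With s the input size and K = c s^k + c, s >= 1 gives K + 1 <= (2c + 1) s^k; squaring yields the
   exponent 2k and the factor (2c + 1)^2. *)
exists (k * 2)%N, 1%N, (8 * ((2 * c + 1) ^ 2)%:R)^-1; split.
  by rewrite invr_gt0 mulr_gt0 // ltr0n expn_gt0 addn1.
move=> x s1 [z1 [z2 [hz1 hz2 z12]]] v; rewrite rho0E => hv.
have [lo hlo] := hc x.
have s_gt0 : (0 < size x ^ k)%N by rewrite expn_gt0 s1.
have := @LA_variance_ge _ (fun i => cost x (enum_val i)) lo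
  (c * size x ^ k + c) v (enum_rank_in hz1 z1) (enum_rank_in hz1 z2).
rewrite !enum_rankK_in // => /(_ z12 _ hv) hb.
apply: le_trans (hb _); last by move=> i; apply: hlo; exact: enum_valP.
rewrite -invfM lef_pV2 ?posrE ?mulr_gt0 ?ltr0n ?expn_gt0 ?s1 ?addn1 //.
rewrite -mulrA ler_pM2l // -natrM ler_nat expnM -expnMn leq_exp2r //.
by nia.
Qed.
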